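(* The Euler–Mascheroni constant $\gamma$ has the following series representation, containing only rational terms: $$\gamma=-1+\sum_{n=2}^{\infty}(n-2)!\sum_{k=1}^{n}\frac{(-1)^{1+k}}{(n-k)!\,k^k}=-1+\frac34+\frac{31}{108}+\frac{517}{3456}+\frac{322537}{3600000}+\cdots,$$ where the displayed numerical terms after $-1$ are those for $n=2,3,4,5$.
   Context: The infinite series is understood as the limit of its partial sums over $n$. *)

(* Defs.v *)
From mathcomp Require Import all_boot all_order all_algebra.
From mathcomp Require Import all_classical all_reals all_analysis.
Set Implicit Arguments.
Unset Strict Implicit.
Unset Printing Implicit Defensive.
Import Order.TTheory GRing.Theory Num.Theory.
Import numFieldNormedType.Exports.
Local Open Scope classical_set_scope.
Local Open Scope ring_scope.

Definition euler_mascheroni_seq (R : realType) (n : nat) : R :=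
  \sum_(1 <= k < n.+1) k%:R^-1 - ln n%:R.

Definition euler_mascheroni (R : realType) : R := limn (@euler_mascheroni_seq R).

(* [lim] is total: this is what makes [euler_mascheroni] meaningful. *)
Lemma cvg_euler_mascheroni (R : realType) :
  @euler_mascheroni_seq R n @[n --> \oo] --> euler_mascheroni R.
Proof.
rewrite /euler_mascheroni.
have decr n : euler_mascheroni_seq R n.+2 <= euler_mascheroni_seq R n.+1.
  rewrite /euler_mascheroni_seq big_nat_recr //= -addrA lerD2l.
  have -> : ln (n.+2%:R : R) = ln n.+1%:R - ln (1 - n.+2%:R^-1).
    have -> : 1 - n.+2%:R^-1 = n.+1%:R / n.+2%:R :> R.
      have -> : n.+1%:R = n.+2%:R - 1 :> R by rewrite -[n.+2%:R]natr1 addrK.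
      by rewrite mulrBl mul1r divff// pnatr_eq0.
    by rewrite ln_div ?posrE ?ltr0n// opprB addrC subrK.
  rewrite opprB addrA gerDr addrC -lerBrDr sub0r.
  apply: le_ln1Dx; rewrite ltrN2.
  by rewrite invf_lt1 ?ltr0n// ltr1n.
have lb n : ln (n.+1%:R : R) <= \sum_(1 <= k < n.+1) k%:R^-1.
  elim: n => [|n IH]; first by rewrite big_geq// ln1.
  rewrite big_nat_recr//=; apply: le_trans (lerD IH (lexx _)).
  rewrite -lerBlDl -ln_div ?posrE ?ltr0n//.
  have -> : n.+2%:R / n.+1%:R = 1 + n.+1%:R^-1 :> R.
    by rewrite -[n.+2]addn1 natrD mulrDl divff ?pnatr_eq0// mul1r.
  apply: le_ln1Dx; apply: lt_trans (_ : 0 < _); first by rewrite oppr_lt0.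
  by rewrite invr_gt0 ltr0n.
rewrite -(cvg_shiftS (@euler_mascheroni_seq R)) /=.
suff /cvg_ex[l hl] : cvgn (fun n => euler_mascheroni_seq R n.+1).
  have /cvg_lim -> // : @euler_mascheroni_seq R @ \oo --> l.
  by rewrite -cvg_shiftS.
apply: nonincreasing_is_cvgn; first exact/nonincreasing_seqP.
exists 0 => _ [n _ <-]; rewrite subr_ge0.
apply: le_trans (lb n.+1); rewrite ler_ln ?posrE ?ltr0n// ler_nat.
exact: leqnSn.
Qed.

Definition series_term (R : realType) (n : nat) : R :=
  (n - 2)`!%:R *
  \sum_(1 <= k < n.+1) (-1) ^+ (1 + k) / ((n - k)`!%:R * k%:R ^+ k).

(* Main.v *)
Require Import Defs.
From mathcomp Require Import all_boot all_order all_algebra.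
From mathcomp Require Import all_classical all_reals all_analysis.
From mathcomp Require Import measurable_realfun ring lra.
Set Implicit Arguments.
Unset Strict Implicit.
Unset Printing Implicit Defensive.
Import Order.TTheory GRing.Theory Num.Theory.
Import numFieldNormedType.Exports.
Local Open Scope classical_set_scope.
Local Open Scope ring_scope.

(** The series is obtained by integrating the expansion
    - ln (1 - x) = sum_(m >= 1) x^m / m term by term against the weight
    exp(-t) on the half-line t > 0, with x = 1 - t exp(-t).

    By the binomial theorem and the moments
    int t^i exp(-(i+1) t) dt = i! / (i+1)^(i+1), the integral of
    (1 - t exp(-t))^m exp(-t) / m is the term of index n = m + 1 of the series
    ([integral_pow_onem_idM_expRN]). All powers of x are nonnegative, so
    monotone convergence ([cvg_integral_ln_series]) shows that the sum of the
    series is the integral of - ln (t exp(-t)) = t - ln t against exp(-t).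

    It remains to see that this integral, call it I, equals 1 + gamma
    ([integral_id_sub_ln_expRN]). The same termwise integration with
    x = exp(-t/n) turns the integral of - ln (1 - exp(-t/n)) into the
    telescoping sum of 1/m - 1/(m+n), which is the harmonic number H_n
    ([integral_ln_onem_expRN]). Since 1 - exp(-s) lies between s exp(-s) and s,
    the function - ln (1 - exp(-t/n)) differs from ln n - ln t by at most t/n;
    integrating, I + ln n <= 1 + H_n <= I + ln n + 1/n, and n tends to
    infinity. *)

(** * Moments of the exponential weight *)

Lemma is_derive_exprn (R : realType) (n : nat) (x : R) :
  is_derive x 1 (fun y : R => y ^+ n.+1) (n.+1%:R * x ^+ n).
Proof.
have := @is_deriveX R R id n.+1 x 1 1 (is_derive_id _ _).
by rewrite exprfctE /GRing.scale/= mulr1.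
Qed.

Lemma is_derive_expRN (R : realType) (a x : R) :
  is_derive x 1 (fun y : R => expR (- (a * y))) (- (a * expR (- (a * x)))).
Proof.
have d : is_derive x 1 (fun y : R => - (a * y)) (- a).
  by apply: is_derive_eq; rewrite /GRing.scale/= mulr1.
have := @is_derive1_comp R expR _ x _ _ (is_derive_expR _) d.
by rewrite /comp mulrN mulrC.
Qed.

(** One term of the exponential series, of degree j + 1, already dominates
    the power t^j. *)
Lemma cvg_pow_expRN (R : realType) (a : R) (j : nat) : 0 < a ->
  t ^+ j * expR (- (a * t)) @[t --> +oo] --> (0 : R).
Proof.
move=> a0; apply/cvgrPdist_le => e e0; near=> t.
have t0 : 0 < t by near: t; apply: nbhs_pinfty_gt; exact: num_real.
have at0 : 0 < a * t by exact: mulr_gt0.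
rewrite sub0r normrN ger0_norm; last first.
  by rewrite mulr_ge0 ?expR_ge0 ?exprn_ge0// ltW.
rewrite expRN ler_pdivrMr ?expR_gt0//.
have h : (a * t) ^+ j.+1 / j.+1`!%:R <= expR (a * t).
  by apply: le_trans (expR_ge1Dxn j (ltW at0)); rewrite lerDr.
apply: le_trans (ler_wpM2l (ltW e0) h).
rewrite exprMn [t ^+ j.+1]exprS.
have -> : e * (a ^+ j.+1 * (t * t ^+ j) / j.+1`!%:R) =
   t ^+ j * (t / (j.+1`!%:R / (e * a ^+ j.+1))).
  by field; rewrite !lt0r_neq0 ?exprn_gt0 ?ltr0n ?fact_gt0.
rewrite ler_peMr ?exprn_ge0 ?(ltW t0)//.
by rewrite ler_pdivlMr ?mul1r ?divr_gt0 ?mulr_gt0 ?exprn_gt0 ?ltr0n ?fact_gt0//.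
Unshelve. all: by end_near. Qed.

(** Integration by parts, in the form of a recursion on primitives that vanish
    at infinity: the primitive for j + 1 is (j + 1) / a times the one for j,
    minus t^(j+1) exp(-a t) / a. *)
Lemma antiderivative_pow_expRN (R : realType) (a : R) (j : nat) : 0 < a ->
  exists F : R -> R,
  [/\ forall t : R, is_derive t 1 F (t ^+ j * expR (- (a * t))),
      F t @[t --> +oo] --> (0 : R) & F 0 = - (j`!%:R / a ^+ j.+1)].
Proof.
move=> a0; have an0 : a != 0 by rewrite gt_eqF.
have step i (t : R) : is_derive t 1 (fun t => t ^+ i.+1 * expR (- (a * t)))
    (i.+1%:R * (t ^+ i * expR (- (a * t))) - a * (t ^+ i.+1 * expR (- (a * t)))).
  have d1 := is_derive_exprn i t; have d2 := is_derive_expRN a t.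
  apply: is_derive_eq (is_deriveM d1 d2) _.
  by rewrite /GRing.scale/= exprS; ring.
elim: j => [|j [F [dF Foo F0]]].
  exists (fun t => - (a^-1 * expR (- (a * t)))); split.
  - move=> t; have d2 := is_derive_expRN a t.
    apply: is_derive_eq; rewrite /GRing.scale/=; field; exact: an0.
  - rewrite -oppr0; apply: cvgN; rewrite -[X in _ --> X](mulr0 a^-1).
    apply: cvgMr; have := @cvg_pow_expRN R a 0 a0.
    by under eq_fun do rewrite expr0 mul1r.
  - by rewrite mulr0 oppr0 expR0 mulr1 fact0 expr1 div1r.
exists (fun t => a^-1 * (j.+1%:R * F t - t ^+ j.+1 * expR (- (a * t)))); split.
- move=> t; have := dF t => ?; have := step j t => ?.
  apply: is_derive_eq; rewrite /GRing.scale/=; field; exact: an0.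
- rewrite -[X in _ --> X](mulr0 a^-1); apply: cvgMr.
  rewrite -[X in _ --> X](subr0 0); apply: cvgB; last exact: cvg_pow_expRN.
  by rewrite -[X in _ --> X](mulr0 j.+1%:R); apply: cvgMr.
- rewrite F0 expr0n mul0r subr0 factS natrM [a ^+ j.+2]exprS.
  by field; rewrite an0 expf_neq0.
Qed.

Lemma integral_pow_expRN (R : realType) (a : R) (j : nat) : 0 < a ->
  (\int[lebesgue_measure]_(t in `]0%R, +oo[) (t ^+ j * expR (- (a * t)))%:E
    = (j`!%:R / a ^+ j.+1)%:E)%E.
Proof.
move=> a0.
have [F [dF Foo F0]] := antiderivative_pow_expRN j a0.
have cf : continuous (fun t : R => t ^+ j * expR (- (a * t))).
  move=> t; apply: cvgM; first exact: exprn_continuous.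
  apply: continuous_comp; last exact: continuous_expR.
  by apply: continuousN; apply: mulrl_continuous.
have cF : continuous F.
  move=> t; have [dt _] := dF t.
  exact/differentiable_continuous/derivable1_diffP.
rewrite integral_itv_obnd_cbnd; last first.
  apply/measurable_EFinP/measurable_funTS; exact: continuous_measurable_fun.
rewrite (@ge0_continuous_FTC2y _ _ F 0 0).
- by rewrite F0 EFinN oppeK add0e.
- by move=> t t0; rewrite mulr_ge0 ?exprn_ge0 ?expR_ge0.
- exact: continuous_subspaceT.
- exact: Foo.
- by move=> t _; have [] := dF t.
- exact/cvg_at_right_filter/cF.
- by move=> t _; rewrite derive1E; have [] := dF t.
Qed.

Lemma integrable_pow_expRN (R : realType) (a : R) (j : nat) : 0 < a ->
  (@lebesgue_measure R).-integrable `]0, +oo[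
    (fun t : R => (t ^+ j * expR (- (a * t)))%:E).
Proof.
move=> a0; apply/integrableP; split.
  apply/measurable_EFinP; apply: measurable_funM.
    by apply: measurable_funTS; exact: exprn_measurable.
  apply: measurable_funTS; apply: measurableT_comp => //.
  by apply: measurableT_comp => //; exact: measurable_funM.
rewrite [X in (X < _)%E](_ : _ = (j`!%:R / a ^+ j.+1)%:E) ?ltry//.
rewrite -integral_pow_expRN//; apply: eq_integral.
move=> t; rewrite inE/= in_itv/= andbT => t0.
by rewrite ger0_norm// mulr_ge0 ?expR_ge0// exprn_ge0// ltW.
Qed.

(** * The logarithmic series and its termwise integration *)

(** The remainder, as a function of x, has derivative x^N / (1 - x), which is
    increasing; so the mean value theorem bounds it by x times that derivative,
    and x < 1. *)
Lemma ln_series_remainder (R : realType) (x : R) (N : nat) : 0 <= x < 1 ->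
  `|- ln (1 - x) - \sum_(m < N) x ^+ m.+1 / m.+1%:R| <= x ^+ N / (1 - x).
Proof.
move=> /andP[x0 x1]; have x1' : 0 < 1 - x by rewrite subr_gt0.
pose g y : R := - ln (1 - y) - \sum_(m < N) y ^+ m.+1 / m.+1%:R.
have dg (y : R) : y < 1 -> is_derive y 1 g (y ^+ N / (1 - y)).
  move=> y1; have y1' : 0 < 1 - y by rewrite subr_gt0.
  have d1 : is_derive y 1 (fun y : R => ln (1 - y)) (- (1 - y)^-1).
    have := @is_derive1_ln R (1 - y) y1' => ?.
    by apply: is_derive_eq; rewrite add0r mul1r mulrN1.
  have d2 : is_derive y 1 (fun y : R => \sum_(m < N) y ^+ m.+1 / m.+1%:R)
                          (\sum_(m < N) y ^+ m).
    elim: N {g} => [|n IH].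
      rewrite big_ord0; under eq_fun do rewrite big_ord0; exact: is_derive_cst.
    rewrite big_ord_recr/=; under eq_fun do rewrite big_ord_recr/=.
    apply: is_deriveD; have dX := is_derive_exprn n y.
    have := is_deriveZ n.+1%:R^-1 dX.
    rewrite /GRing.scale/= mulKf ?pnatr_eq0//.
    by congr (is_derive _ _ _ _); apply/funext => z; rewrite mulrC.
  apply: is_derive_eq; have := subrX1 y N => h.
  apply: (@mulIf _ (1 - y)); first by rewrite gt_eqF.
  rewrite opprK mulrBl mulVf ?gt_eqF// divfK ?gt_eqF//.
  by rewrite mulrC -[1 - y]opprB mulNr -h; ring.
have cg : {within `[0, x], continuous g}.
  apply: continuous_in_subspaceT => y; rewrite inE/= in_itv/= => /andP[_ yx].
  have := dg y (le_lt_trans yx x1) => -[dy _].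
  exact/differentiable_continuous/derivable1_diffP.
have dgx (y : R) : y \in `]0, x[ -> is_derive y 1 g (y ^+ N / (1 - y)).
  by rewrite in_itv/= => /andP[_ yx]; exact/dg/(lt_trans yx).
have [c + ] := @MVT_segment R g (fun y => y ^+ N / (1 - y)) 0 x x0 dgx cg.
rewrite in_itv/= => /andP[c0 cx]; have c1' : 0 < 1 - c by lra.
have -> : g 0 = 0.
  rewrite /g subr0 ln1 oppr0 sub0r big1 ?oppr0// => i _.
  by rewrite expr0n mul0r.
rewrite !subr0 -/(g x) => ->; rewrite ger0_norm; last first.
  by apply: mulr_ge0 => //; rewrite divr_ge0 ?exprn_ge0// ltW.
apply: (@le_trans _ _ (c ^+ N / (1 - c))).
  by apply: ler_piMr (ltW x1); rewrite divr_ge0 ?exprn_ge0// ltW.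
apply: ler_pM; rewrite ?exprn_ge0 ?invr_ge0 ?(ltW c1')//.
  by rewrite lerXn2r ?nnegrE.
by rewrite lef_pV2 ?posrE// lerD2l lerN2.
Qed.

Lemma cvg_ln_series (R : realType) (x : R) : 0 <= x < 1 ->
  \sum_(m < N) x ^+ m.+1 / m.+1%:R @[N --> \oo] --> - ln (1 - x).
Proof.
move=> x01; apply/cvgrPdist_le => e e0.
have /andP[x0 x1] := x01.
have : x ^+ N / (1 - x) @[N --> \oo] --> 0.
  rewrite -[X in _ --> X](mul0r (1 - x)^-1); apply: cvgMl.
  by apply: cvg_expr; rewrite ger0_norm.
move=> /cvgrPdist_le /(_ e e0) [n _ hn]; exists n => // N /hn /=.
rewrite sub0r normrN => h; have r := ln_series_remainder N x01.
exact: le_trans r (le_trans (ler_norm _) h).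
Qed.

(** Monotone convergence for the partial sums of the logarithmic series. The
    moments are given as real numbers c m so that the partial sums on the left
    are real, although the integral on the right may a priori be infinite. *)
Lemma cvg_integral_ln_series (R : realType) (x : R -> R) (c : nat -> R) :
  measurable_fun (`]0, +oo[ : set R) x -> (forall t, 0 < t -> 0 <= x t < 1) ->
  (forall m, (\int[lebesgue_measure]_(t in `]0%R, +oo[) (x t ^+ m.+1 * expR (- t))%:E
    = (c m)%:E)%E) ->
  (\sum_(m < N) c m / m.+1%:R)%:E @[N --> \oo] -->
  (\int[lebesgue_measure]_(t in `]0%R, +oo[) (- ln (1 - x t) * expR (- t))%:E)%E.
Proof.
move=> mx x01 cE.
pose f N t := ((\sum_(m < N) x t ^+ m.+1 / m.+1%:R) * expR (- t))%:E.
have mE : measurable_fun (`]0, +oo[ : set R) (fun t : R => expR (- t)).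
  by apply: measurableT_comp => //; exact: measurable_funTS.
have mxn m : measurable_fun (`]0, +oo[ : set R) (fun t : R => x t ^+ m.+1 * expR (- t)).
  by apply: measurable_funM => //; exact: measurable_funX.
have fE N : f N = fun t => (\sum_(m < N) (m.+1%:R^-1)%:E * (x t ^+ m.+1 * expR (- t))%:E)%E.
  apply/funext => t; rewrite /f mulr_suml -sumEFin; apply: eq_bigr => m _.
  by rewrite -EFinM mulrA [_^-1 * _]mulrC.
have x0 m t : 0 < t -> 0 <= x t ^+ m.
  by move=> /x01/andP[? _]; exact: exprn_ge0.
have mf N : measurable_fun (`]0, +oo[ : set R) (f N).
  rewrite fE; apply: emeasurable_sum => m; apply: measurable_funeM.
  by apply/measurable_EFinP; exact: mxn.
have -> : (fun N => (\sum_(m < N) c m / m.+1%:R)%:E) =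
    fun N => (\int[lebesgue_measure]_(t in `]0%R, +oo[) f N t)%E.
  apply/funext => N; rewrite fE ge0_integral_sum//.
  - rewrite -sumEFin; apply: eq_bigr => m _.
    rewrite ge0_integralZl//.
    + by rewrite cE -EFinM mulrC.
    + by apply/measurable_EFinP; exact: mxn.
    + move=> t; rewrite /= in_itv/= andbT => t0.
      by rewrite lee_fin mulr_ge0 ?x0 ?expR_ge0.
  - by move=> m; apply: measurable_funeM; apply/measurable_EFinP; exact: mxn.
  - move=> m t; rewrite /= in_itv/= andbT => t0.
    by rewrite -EFinM lee_fin !mulr_ge0 ?x0 ?expR_ge0// invr_ge0.
rewrite [X in _ --> X](_ : _ =
    (\int[lebesgue_measure]_(t in `]0%R, +oo[) limn (f ^~ t))%E).
  apply: cvg_monotone_convergence => //.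
  - move=> N t; rewrite /= in_itv/= andbT => t0; rewrite lee_fin mulr_ge0 ?expR_ge0//.
    by apply: sumr_ge0 => m _; rewrite divr_ge0 ?x0.
  - move=> t; rewrite /= in_itv/= andbT => t0.
    apply/nondecreasing_seqP => N; rewrite lee_fin ler_wpM2r ?expR_ge0//.
    by rewrite big_ord_recr/= lerDl divr_ge0 ?x0.
apply: eq_integral => t; rewrite inE/= in_itv/= andbT => t0; apply/esym.
apply/cvg_lim => //; apply: cvg_EFin; first exact: nearW.
apply: cvgMl; exact/cvg_ln_series/x01.
Qed.

(** * The Euler-Mascheroni constant as an integral *)

(** Raising the shift n by one adds a telescoping sum, which contributes
    1/(n+1) in the limit. *)
Lemma cvg_sum_inv_shift (R : realType) (n : nat) :
  \sum_(m < N) (m.+1%:R^-1 - (n + m.+1)%:R^-1) @[N --> \oo] -->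
  (\sum_(1 <= k < n.+1) k%:R^-1 : R).
Proof.
elim: n => [|n IH].
  rewrite big_geq//; under eq_fun do under eq_bigr do rewrite add0n subrr.
  by under eq_fun do rewrite sumr_const mul0rn; exact: cvg_cst.
rewrite big_nat_recr//=.
have tele N : \sum_(m < N) (m.+1%:R^-1 - (n.+1 + m.+1)%:R^-1) =
   \sum_(m < N) (m.+1%:R^-1 - (n + m.+1)%:R^-1) + (n.+1%:R^-1 - (n + N).+1%:R^-1) :> R.
  elim: N => [|N IHN]; first by rewrite !big_ord0 addn0 subrr addr0.
  by rewrite !big_ord_recr/= IHN addSn !addnS; ring.
under eq_fun do rewrite tele.
apply: cvgD => //; rewrite -[X in _ --> X]subr0; apply: cvgB; first exact: cvg_cst.
have -> : (fun N : nat => (n + N).+1%:R^-1 : R) = (fun N => harmonic (N + n)).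
  by apply/funext => N; rewrite /harmonic/= addnC.
by rewrite cvg_shiftn; exact: cvg_harmonic.
Qed.

(** With x = exp(-t/(n+1)), the power x^(m+1) times the weight is a single
    exponential of rate 1 + (m+1)/(n+1), and partial fractions give
    1/(m+1) - 1/(n+m+2) for the term of index m. The integral is the mean of
    the maximum of n + 1 independent unit exponential variables, whence the
    harmonic number. *)
Lemma integral_ln_onem_expRN (R : realType) (n : nat) :
  (\int[lebesgue_measure]_(t in `]0%R, +oo[)
     (- ln (1 - expR (- (t / n.+1%:R))) * expR (- t))%:E
   = (\sum_(1 <= k < n.+2) k%:R^-1 : R)%:E)%E.
Proof.
apply/esym.
pose c m : R := n.+1%:R / (n.+1 + m.+1)%:R.
have n0 : 0 < n.+1%:R^-1 :> R by rewrite invr_gt0.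
have h : (\sum_(m < N) c m / m.+1%:R)%:E @[N --> \oo] -->
    (\int[lebesgue_measure]_(t in `]0%R, +oo[)
      (- ln (1 - expR (- (t / n.+1%:R))) * expR (- t))%:E)%E.
  apply: (@cvg_integral_ln_series R (fun t => expR (- (t / n.+1%:R)))).
  - apply: measurable_funTS; apply: measurableT_comp => //.
    by apply: measurableT_comp => //; exact: measurable_funM.
  - by move=> t t0; rewrite expR_ge0 expR_lt1 oppr_lt0 mulr_gt0.
  - move=> m; have a0 : 0 < 1 + m.+1%:R / n.+1%:R :> R.
      by rewrite addr_gt0// divr_gt0.
    have := integral_pow_expRN 0 a0.
    rewrite fact0 expr1 div1r /c => h0.
    rewrite (_ : n.+1%:R / _ = (1 + m.+1%:R / n.+1%:R)^-1); last first.
      rewrite natrD; field.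
      by rewrite !nat1r -natrD !pnatr_eq0.
    rewrite -h0; apply: eq_integral => t _.
    rewrite expr0 mul1r -expRM_natl -expRD; congr (expR _)%:E.
    by ring.
have := @cvg_sum_inv_shift R n.+1.
have -> : (fun N => \sum_(m < N) (m.+1%:R^-1 - (n.+1 + m.+1)%:R^-1) : R) =
  (fun N => \sum_(m < N) c m / m.+1%:R).
  apply/funext => N; apply: eq_bigr => m _; rewrite /c natrD.
  by field; rewrite !nat1r -!natrD !pnatr_eq0.
move=> h'; apply: cvg_unique h => //.
by apply: cvg_EFin; [exact: nearW|exact: h'].
Qed.
(** The logarithmic form of s exp(-s) <= 1 - exp(-s) <= s. *)
Lemma ln_onem_expRN (R : realType) (s : R) : 0 < s ->
  ln s - s <= ln (1 - expR (- s)) <= ln s.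
Proof.
move=> s0; have h1 : 0 < 1 - expR (- s) by rewrite subr_gt0 expR_lt1 oppr_lt0.
apply/andP; split; last first.
  by rewrite ler_ln ?posrE//; have h := expR_ge1Dx (- s); lra.
rewrite -[X in _ + X <= _]expRK -lnM ?posrE ?expR_gt0//.
rewrite ler_ln ?posrE ?mulr_gt0 ?expR_gt0//.
rewrite -(ler_pM2r (expR_gt0 s)) -mulrA mulrBl mul1r -!expRD addNr expR0 mulr1.
by have h := expR_ge1Dx s; lra.
Qed.

(** The summand t makes the integrand positive, as ln t < t. Every integral
    in the sandwich then has a nonnegative integrand, so additivity and
    monotonicity hold before the finiteness of the integral is known, and that
    finiteness comes out of the lower bound. *)
Lemma integral_id_sub_ln_expRN (R : realType) :
  (\int[lebesgue_measure]_(t in `]0%R, +oo[) ((t - ln t) * expR (- t))%:E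
   = (1 + euler_mascheroni R)%:E)%E.
Proof.
pose D : set R := `]0%R, +oo[%classic.
have mD : measurable D by exact: measurable_itv.
pose H n : R := \sum_(1 <= k < n.+2) k%:R^-1.
have Int0 : (\int[lebesgue_measure]_(t in D) (expR (- t))%:E = 1%:E)%E.
  have := @integral_pow_expRN R 1 0 ltr01.
  by rewrite fact0 expr1 divr1; under eq_integral do rewrite expr0 !mul1r.
have Int1 : (\int[lebesgue_measure]_(t in D) (t * expR (- t))%:E = 1%:E)%E.
  have := @integral_pow_expRN R 1 1 ltr01.
  by rewrite factS fact0 expr1n muln1 divr1; under eq_integral do rewrite expr1 !mul1r.
have mE : measurable_fun D (fun t : R => expR (- t)).
  by apply: measurableT_comp => //; exact: measurable_funTS.
have mln : measurable_fun D (@ln R) by exact: measurable_funTS.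
have mI : measurable_fun D (fun t : R => (t - ln t) * expR (- t)).
  by apply: measurable_funM => //; exact: measurable_funB.
have mtE : measurable_fun D (fun t : R => t * expR (- t)).
  by apply: measurable_funM => //; exact: measurable_id.
have mL n : measurable_fun D
    (fun t : R => - ln (1 - expR (- (t / n.+1%:R))) * expR (- t)).
  apply: measurable_funM => //; apply: measurableT_comp => //.
  apply: measurableT_comp => //; apply: measurable_funB => //.
  apply: measurableT_comp => //; apply: measurableT_comp => //.
  exact: measurable_funM.
have Dt t : D t -> 0 < t by rewrite /D/= in_itv/= andbT.
set I := (\int[lebesgue_measure]_(t in D) ((t - ln t) * expR (- t))%:E)%E.
have I0 t : 0 < t -> 0 <= t - ln t.
  by move=> t0; rewrite subr_ge0 ltW// ln_sublinear.
have lnn0 n : 0 <= ln n.+1%:R :> R by rewrite ln_ge0// ler1n.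
have L0 n t : 0 < t -> 0 <= - ln (1 - expR (- (t / n.+1%:R))).
  by move=> t0; rewrite oppr_ge0 ln_le0// gerBl expR_ge0.
have IntL n : (\int[lebesgue_measure]_(t in D)
   (t * expR (- t) + - ln (1 - expR (- (t / n.+1%:R))) * expR (- t))%:E
   = (1 + H n)%:E)%E.
  rewrite [RHS]EFinD -Int1 /H -integral_ln_onem_expRN -ge0_integralD//.
  - by move=> t /Dt t0; rewrite lee_fin mulr_ge0 ?expR_ge0// ltW.
  - exact/measurable_EFinP.
  - by move=> t /Dt t0; rewrite lee_fin mulr_ge0 ?expR_ge0// L0.
  - by apply/measurable_EFinP; exact: mL.
have lnq n t : 0 < t -> ln (t / n.+1%:R) = ln t - ln n.+1%:R :> R.
  by move=> t0; rewrite ln_div ?posrE.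
have IntC (c : R) : 0 <= c ->
    (\int[lebesgue_measure]_(t in D) (c * expR (- t))%:E = c%:E)%E.
  move=> c0; under eq_integral do rewrite EFinM.
  rewrite ge0_integralZl_EFin//.
  - by rewrite Int0 mule1.
  - exact/measurable_EFinP.
have mC (c : R) : measurable_fun D (fun t : R => (c * expR (- t))%:E).
  by apply/measurable_EFinP; exact: measurable_funM.
have Ipos t : D t -> (0 <= ((t - ln t) * expR (- t))%:E)%E.
  by move=> /Dt t0; rewrite lee_fin mulr_ge0 ?expR_ge0// I0.
have Cpos (c : R) t : 0 <= c -> (0 <= (c * expR (- t))%:E)%E.
  by move=> c0; rewrite lee_fin mulr_ge0 ?expR_ge0.
have IntIC n : (\int[lebesgue_measure]_(t in D)
    (((t - ln t) * expR (- t))%:E + (ln n.+1%:R * expR (- t))%:E)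
    = I + (ln n.+1%:R)%:E)%E.
  rewrite ge0_integralD//.
  - by rewrite IntC.
  - exact/measurable_EFinP.
  - by move=> t _; exact: Cpos.
  - exact: mC.
have mIC n : measurable_fun D (fun t : R =>
    ((t - ln t) * expR (- t))%:E + (ln n.+1%:R * expR (- t))%:E)%E.
  by apply: emeasurable_funD => //; exact/measurable_EFinP.
have ICpos n t : D t ->
    (0 <= ((t - ln t) * expR (- t))%:E + (ln n.+1%:R * expR (- t))%:E)%E.
  by move=> t0; rewrite adde_ge0 ?Ipos ?Cpos.
have mtL n : measurable_fun D (fun t : R =>
   (t * expR (- t) + - ln (1 - expR (- (t / n.+1%:R))) * expR (- t))%:E).
  by apply/measurable_EFinP; exact: measurable_funD.
have lower n : (I + (ln n.+1%:R)%:E <= (1 + H n)%:E)%E.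
  rewrite -IntIC -IntL; apply: ge0_le_integral => //.
  - by move=> t; exact: ICpos.
  - exact: mIC.
  - exact: mtL.
  move=> t /Dt t0; rewrite -EFinD lee_fin -!mulrDl ler_wpM2r ?expR_ge0//.
  have s0 : 0 < t / n.+1%:R by rewrite divr_gt0.
  have /andP[_] := ln_onem_expRN s0.
  by rewrite lnq// => ?; lra.
have upper n : ((1 + H n)%:E <= I + (ln n.+1%:R)%:E + (n.+1%:R^-1)%:E)%E.
  have n0 : 0 <= n.+1%:R^-1 :> R by rewrite invr_ge0.
  have mtE' : measurable_fun D (fun t : R => (n.+1%:R^-1 * (t * expR (- t)))%:E).
    by apply/measurable_EFinP; exact: measurable_funM.
  have tpos t : D t -> (0 <= (n.+1%:R^-1 * (t * expR (- t)))%:E)%E.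
    by move=> /Dt t0; rewrite lee_fin !mulr_ge0 ?expR_ge0// ltW.
  have -> : (n.+1%:R^-1)%:E = (\int[lebesgue_measure]_(t in D)
      (n.+1%:R^-1 * (t * expR (- t)))%:E)%E.
    under eq_integral do rewrite EFinM.
    rewrite ge0_integralZl_EFin//.
    - by rewrite Int1 mule1.
    - by move=> t /Dt t0; rewrite lee_fin mulr_ge0 ?expR_ge0// ltW.
    - exact/measurable_EFinP.
  rewrite -IntIC -IntL -ge0_integralD//; last 2 first.
  - by move=> t; exact: ICpos.
  - exact: mIC.
  apply: ge0_le_integral => //.
  - move=> t /Dt t0; rewrite lee_fin -mulrDl mulr_ge0 ?expR_ge0//.
    by rewrite addr_ge0 ?L0// ltW.
  - exact: mtL.
  - by apply: emeasurable_funD => //; exact: mIC.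
  move=> t /Dt t0; rewrite -!EFinD lee_fin mulrA -!mulrDl ler_wpM2r ?expR_ge0//.
  have s0 : 0 < t / n.+1%:R by rewrite divr_gt0.
  have /andP[+ _] := ln_onem_expRN s0.
  by rewrite lnq// [_^-1 * t]mulrC; move: (t / _) => s *; lra.
(* For n = 0 the logarithm vanishes and the lower bound reads I <= 2. *)
have Ifin : I \is a fin_num.
  rewrite ge0_fin_numE.
    have := lower 0; rewrite ln1 adde0 => /le_lt_trans; apply; exact: ltry.
  by apply: integral_ge0 => t /Dt t0; rewrite lee_fin mulr_ge0 ?expR_ge0// I0.
rewrite -(fineK Ifin); congr (_%:E).
suff : euler_mascheroni R = fine I - 1 by move=> ->; rewrite addrC subrK.
have h := @cvg_euler_mascheroni R; rewrite -cvg_shiftS in h.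
apply: cvg_unique h _ => //.
apply: (@squeeze_cvgr _ _ _ _ (fun n => fine I - 1) (fun n => fine I - 1 + n.+1%:R^-1)).
- near=> n; have := lower n; have := upper n.
  rewrite -(fineK Ifin) -!EFinD !lee_fin /H /euler_mascheroni_seq /=.
  by move: (_^-1) => r *; apply/andP; split; lra.
- exact: cvg_cst.
- rewrite -[X in _ --> X]addr0; apply: cvgD; [exact: cvg_cst|exact: cvg_harmonic].
Unshelve. all: by end_near. Qed.

(** * The rational terms and their sum *)

(** With n = m + 2 and k = i + 1, the binomial coefficient turns the moment
    i! / (i+1)^(i+1) into (m+1)! / ((n-k)! k^k), and (m+1)! = (m+1) (n-2)!. *)
Lemma integral_pow_onem_idM_expRN (R : realType) (m : nat) :
  (\int[lebesgue_measure]_(t in `]0%R, +oo[)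
     ((1 - t * expR (- t)) ^+ m.+1 * expR (- t))%:E
   = (m.+1%:R * series_term R m.+2)%:E)%E.
Proof.
pose k i : R := (-1) ^+ i *+ 'C(m.+1, i).
have expand (t : R) : ((1 - t * expR (- t)) ^+ m.+1 * expR (- t))%:E =
    (\sum_(i < m.+2) (k i)%:E * (t ^+ i * expR (- (i.+1%:R * t)))%:E)%E.
  rewrite sumEFin exprBn mulr_suml; congr (_%:E).
  apply: eq_bigr => i _; rewrite expr1n mulr1 /k exprMn -expRM_natl.
  rewrite -!mulrnAl -!mulrA -expRD; congr (_ * (_ * expR _)).
  by rewrite mulrS; ring.
under eq_integral do rewrite expand.
rewrite integral_sum//; last first.
  by move=> i; apply: integrableZl => //; exact: integrable_pow_expRN.
rewrite (eq_bigr (fun i : 'I_m.+2 => (k i * (i`!%:R / i.+1%:R ^+ i.+1))%:E)); last first.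
  move=> i _; rewrite integralZl//; last exact: integrable_pow_expRN.
  by rewrite integral_pow_expRN.
rewrite sumEFin; congr (_%:E).
rewrite /series_term big_add1/= big_mkord mulrA -natrM subSS subn1/= -factS mulr_sumr.
apply: eq_bigr => -[i im] _ /=.
rewrite !exprS !mulN1r opprK /k subSS -(bin_fact (im : (i <= m.+1)%N)) !natrM -mulr_natr.
by field; rewrite nat1r expf_neq0 ?pnatr_eq0 ?andbT -?lt0n ?fact_gt0//.
Qed.

Lemma cvg_sum_series_term (R : realType) :
  (-1 + \sum_(2 <= n < N) series_term R n) @[N --> \oo] --> euler_mascheroni R.
Proof.
rewrite -(cvg_shiftn 2).
have -> : (fun N => -1 + \sum_(2 <= n < N + 2) series_term R n) =
    (fun N => -1 + \sum_(m < N) series_term R m.+2).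
  apply/funext => N; rewrite -{1}[2%N]add0n big_addn addnK big_mkord.
  by congr (_ + _); apply: eq_bigr => m _; rewrite addn2.
rewrite -[euler_mascheroni R](addKr 1); apply: cvgD; first exact: cvg_cst.
have : (\sum_(m < N) (m.+1%:R * series_term R m.+2) / m.+1%:R)%:E @[N --> \oo] -->
    (\int[lebesgue_measure]_(t in `]0%R, +oo[)
      (- ln (1 - (1 - t * expR (- t))) * expR (- t))%:E)%E.
  apply: (@cvg_integral_ln_series R (fun t => 1 - t * expR (- t))
    (fun m => m.+1%:R * series_term R m.+2)).
  - apply: measurable_funTS; apply: measurable_funB => //.
    by apply: measurable_funM => //; exact: measurableT_comp.
  - move=> t t0; rewrite subr_ge0 ltrBlDr ltrDl mulr_gt0 ?expR_gt0// andbT.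
    rewrite expRN ler_pdivrMr ?expR_gt0// mul1r.
    by have h := expR_ge1Dx t; lra.
  - exact: integral_pow_onem_idM_expRN.
have -> : (fun N => (\sum_(m < N) (m.+1%:R * series_term R m.+2) / m.+1%:R)%:E) =
    (fun N => (\sum_(m < N) series_term R m.+2)%:E).
  apply/funext => N; congr (_%:E); apply: eq_bigr => m _.
  by rewrite mulrC mulKf ?pnatr_eq0.
suff -> : (\int[lebesgue_measure]_(t in `]0%R, +oo[)
    (- ln (1 - (1 - t * expR (- t))) * expR (- t))%:E)%E =
    (1 + euler_mascheroni R)%:E by move/fine_cvg.
rewrite -integral_id_sub_ln_expRN; apply: eq_integral => t.
rewrite inE/= in_itv/= andbT => t0; congr (_ * _)%:E.
by rewrite subKr lnM ?posrE ?expR_gt0// expRK opprD opprK addrC.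
Qed.

Lemma series_term_rat (R : realType) (n : nat) :
  exists q : rat, series_term R n = ratr q.
Proof.
exists ((n - 2)`!%:R *
  \sum_(1 <= k < n.+1) (-1) ^+ (1 + k) / ((n - k)`!%:R * k%:R ^+ k)).
rewrite rmorphM rmorph_nat rmorph_sum; congr (_ * _); apply: eq_bigr => k _.
by rewrite fmorph_div !rmorphM !rmorphXn rmorphN rmorph1 !rmorph_nat.
Qed.

Theorem corollary2p7 (R : realType) :
  [/\ (-1 + \sum_(2 <= n < N) series_term R n) @[N --> \oo]
        --> euler_mascheroni R,
      (forall n : nat, (2 <= n)%N -> exists q : rat, series_term R n = ratr q)
    & [/\ series_term R 2 = 3 / 4,
          series_term R 3 = 31 / 108,
          series_term R 4 = 517 / 3456
        & series_term R 5 = 322537%:R / 3600000%:R]].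
Proof.
split; last 2 first.
- by move=> n _; exact: series_term_rat.
(* The right-hand sides are hidden while the sums are unfolded, so that their
   large numerals stay in decimal form. *)
- by split; rewrite /series_term; set q := (X in _ = X);
    rewrite unlock /= /index_iota /= ?factS ?fact0 /q; field.
exact: cvg_sum_series_term.
Qed.
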